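(* Let $D\in\Sigma_{p-1}$ and $E\in\Sigma_{q-1}$ be sashes and $n=p+q$. The dual product of $D$ and $E$ is given by $$\Delta_S^*(D\otimes E)=\sum_{\substack{T\subseteq[n]\\ |T|=p}}\gamma_T(D\otimes E),$$ where $\gamma_T(D\otimes E)\in\Sigma_{n-1}$ is the sash built from $D$, $E$ and $T$ by the arrow construction described in the context.
   Context: A sash of length $m\ge 0$ is a tiling of a $1\times m$ rectangle by black $1\times1$ squares, white $1\times1$ squares and white $1\times2$ rectangles; positions are numbered $1,\dots,m$ from left to right, and a rectangle occupies two consecutive positions, its left half and its right half. There is one sash of length $0$, and in addition a formal sash of length $-1$, denoted $\emptyset$. $\Sigma_m$ is the set of sashes of length $m$. $[n]=\{1,\dots,n\}$; $S_n$ is the set of permutations of $[n]$ in one-line notation. Pell permutations: $x\in S_n$ is Pell if $x_i-x_{i+1}\le 2$ for all $i$, and whenever $x_i=x_{i+1}+2$ the value $x_{i+1}+1$ appears to the right of $x_{i+1}$; $P_n$ is the set of these. The map $\pi_\downarrow:S_n\to P_n$ is defined recursively: $\pi_\downarrow(x)=x$ if $x\in P_n$; otherwise choose any $i$ with $x_i>x_{i+1}$ such that either some value strictly between $x_{i+1}$ and $x_i$ appears to the left of $x_i$, or at least two values strictly between $x_{i+1}$ and $x_i$ appear to the right of $x_{i+1}$; swap $x_i$ and $x_{i+1}$ to get $x'$ and put $\pi_\downarrow(x)=\pi_\downarrow(x')$ (known to be well defined). The map $\sigma:S_n\to\Sigma_{n-1}$: position $i$ ($1\le i\le n-1$) of $\sigma(x)$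 is a black square if $i+1$ is to the right of $i$ in $x$, and a white square if $i+1$ is to the left of $i$, except that if $i+1$ is to the right of $i$ and $i+2$ is to the left of $i$ then a rectangle occupies positions $i$ and $i+1$; $\sigma(\emptyset)=\emptyset$, and $\sigma(1)$ is the sash of length $0$. Restricted to $P_n$, $\sigma$ is a bijection onto $\Sigma_{n-1}$ with inverse $\eta$. Extend $\sigma$ linearly (over a field $\mathbb K$). Dual product: for $T=\{t_1<\dots<t_p\}\subseteq[n]$ and $x\in S_p$, $(x)_T$ is the word with $t_j$ in position $i$ when $x_i=j$; $T^C=[n]\setminus T$; $\cdot$ is concatenation of words. Then $\Delta_S^*(D\otimes E)=\sigma\Big(\sum_{T\subseteq[n],\,|T|=p}\pi_\downarrow\big((\eta(D))_T\cdot(\eta(E))_{T^C}\big)\Big)$. Construction of $\gamma_T(D\otimes E)$: write $D$ above $E$. Label $D$ with $T$ by placing the elements of $T$ in increasing order before, between and after the $p-1$ positions of $D$ (so the $h$-th position of $D$ lies between the $h$-th and $(h+1)$-st smallest elements of $T$). Label $E$ likewise with the elements of $T^C$. For each $i\in[n-1]$ draw the $i$-th arrow from label $i$ to label $i+1$. Following the arrows, fill positions $1,\dots,n-1$ of a new sash as follows. Place a rectangle in positions $i$ and $i+1$ if either (1) the $i$-th arrow goes from $D$ to $E$, the $(i+1)$-st arrow goes from $E$ to $D$, and there is a white square or the right half of a rectangle in $D$ between the labels $i$ and $i+2$; or (2) the $i$-th arrow goes from $E$ to $E$, the $(i+1)$-st arrow goes from $E$ to $D$, and there is a black square or the left half of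 a rectangle in $E$ between the labels $i$ and $i+1$. For positions not filled in this way: if the $i$-th arrow goes from $D$ to $D$ (or from $E$ to $E$), place in position $i$ whatever lies between $i$ and $i+1$ in $D$ (or in $E$); if it goes from $D$ to $E$, place a black square; if it goes from $E$ to $D$, place a white square. A left half of a rectangle copied without the corresponding right half immediately after it is replaced by a black square, and a right half copied without the corresponding left half immediately before it is replaced by a white square. *)

(* Defs.v *)
From HB Require Import structures.
From mathcomp Require Import all_boot fingroup perm ssralg.
From mathcomp.multinomials Require Export freeg.

Set Implicit Arguments.
Unset Strict Implicit.
Unset Printing Implicit Defensive.

Import GRing.Theory.

(* Everything is 0-based: the set [n] = {1, ..., n} is 'I_n, the ordinal k
   standing for k + 1, and position k + 1 of a word or of a sash is its k-th
   entry. *)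

Inductive cell := Black | White | LeftHalf | RightHalf.

Definition nat_of_cell c :=
  match c with Black => 0 | White => 1 | LeftHalf => 2 | RightHalf => 3 end.
Definition cell_of_nat k : option cell :=
  match k with
  | 0 => Some Black | 1 => Some White | 2 => Some LeftHalf
  | 3 => Some RightHalf | _ => None
  end.
Lemma nat_of_cellK : pcancel nat_of_cell cell_of_nat.
Proof. by case. Qed.
HB.instance Definition _ := Countable.copy cell (pcan_type nat_of_cellK).
Lemma cell_enumP : Finite.axiom [:: Black; White; LeftHalf; RightHalf].
Proof. by case. Qed.
HB.instance Definition _ := isFinite.Build cell cell_enumP.

(* A tiling is recorded by what covers each position: each left half has to be
   immediately followed by a right half, and each right half immediately
   preceded by a left half.  The black squares added at both ends exclude
   halves sticking out of the rectangle. *)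
Definition is_tiling (s : seq cell) : bool :=
  path (fun a b => (a == LeftHalf) == (b == RightHalf)) Black (rcons s Black).

(* [sash n] is the set Sigma_(n-1) of sashes of length n - 1.  As 0.-1 = 0, the
   unique element of [sash 0] carries no cell: it is the formal sash of
   length -1.  The sash of length 0 is the unique element of [sash 1]. *)
Record sash (n : nat) := Sash {
  cells : n.-1.-tuple cell;
  cells_tiling : is_tiling cells
}.

HB.instance Definition _ n := [isSub for @cells n].
HB.instance Definition _ n := [Finite of sash n by <:].

Lemma is_tilingP (s : seq cell) :
    (0 < size s -> nth Black s 0 != RightHalf) ->
    (forall i, i < size s ->
       (nth Black s i == LeftHalf) = (nth Black s i.+1 == RightHalf)) ->
  is_tiling s.
Proof.
move=> h0 hS; apply/(pathP Black) => i; rewrite size_rcons ltnS => le_i.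
have nthr k : nth Black (rcons s Black) k = nth Black s k.
  rewrite nth_rcons; case: ltngtP => // lk.
    by rewrite nth_default // ltnW.
  by rewrite nth_default ?lk.
rewrite nthr; case: i le_i => [|i] lt_i /=.
  case: (posnP (size s)) => [/size0nil ->//|/h0].
  by case: (nth _ _ _).
by rewrite nthr; apply/eqP/hS.
Qed.

(* In x : 'S_n, x i is the letter in position i of the one-line notation. *)

Definition Pell n (x : 'S_n) : bool :=
  [forall i : 'I_n, forall j : 'I_n, (j == i.+1 :> nat) ==>
     [&& x i <= x j + 2 &
         (x i == x j + 2 :> nat) ==>
           [exists k : 'I_n, (j < k) && (x k == x j + 1 :> nat)]]].

Definition swappable n (x : 'S_n) (i j : 'I_n) : bool :=
  [&& j == i.+1 :> nat, x j < x i &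
      [exists k : 'I_n, (k < i) && (x j < x k < x i)]
      || (2 <= #|[set k : 'I_n | (j < k) && (x j < x k < x i)]|)].

Definition swap n (x : 'S_n) (i j : 'I_n) : 'S_n := (tperm i j * x)%g.

Fixpoint pi_down_rec n (fuel : nat) (x : 'S_n) : 'S_n :=
  if Pell x then x else
  if fuel is fuel'.+1 then
    if [pick ij : 'I_n * 'I_n | swappable x ij.1 ij.2] is Some ij
    then pi_down_rec fuel' (swap x ij.1 ij.2) else x
  else x.

(* A quantity which decreases at each swap, so that the fuel below is never
   exhausted (lemmas [pi_down_eq] and [Pell_pi_down]). *)
Definition weight n (x : 'S_n) : nat := \sum_(k < n) (n - k) * x k.

(* The result is known not to depend on the swaps chosen by [pick]. *)
Definition pi_down n (x : 'S_n) : 'S_n := pi_down_rec (weight x) x.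

Lemma Pell_or_swappable n (x : 'S_n) :
  ~~ Pell x -> exists ij : 'I_n * 'I_n, swappable x ij.1 ij.2.
Proof.
case/forallPn=> i /forallPn[j]; rewrite negb_imply => /andP[/eqP ji nP].
exists (i, j); rewrite /swappable /= ji eqxx /=.
have preim (v : nat) : v < x i -> exists k, x k = v :> nat.
  move=> lt_v; have lt_vn := ltn_trans lt_v (ltn_ord (x i)).
  by exists ((x^-1)%g (Ordinal lt_vn)); rewrite permKV.
have side (k : 'I_n) : x j < x k < x i -> (k < i) || (i.+1 < k).
  case: (ltngtP k i) => //= [lt_ik|/val_inj->]; last by rewrite ltnn andbF.
  by move=> /andP[jk _]; rewrite ltn_neqAle lt_ik andbT -ji;
     apply: contraTneq jk => /val_inj <-; rewrite ltnn.
have lt_ji : x j + 2 <= x i.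
  move: nP; rewrite negb_and => /orP[|]; first by rewrite -ltnNge => /ltnW.
  by rewrite negb_imply => /andP[/eqP-> _].
have ji1 : x j < x i by apply: leq_trans lt_ji; rewrite addn2.
rewrite ji1 /=.
have [k1 k1E] := preim (x j + 1) (leq_trans (eq_leq (esym (addnS _ 1))) lt_ji).
have b1 : x j < x k1 < x i.
  by rewrite k1E addn1 ltnSn /= -addn2.
have [lt1|/= gt1] := orP (side _ b1).
  by apply/orP; left; apply/existsP; exists k1; rewrite lt1.
move: nP; rewrite negb_and => /orP[|]; last first.
  rewrite negb_imply => /andP[_ /existsPn/(_ k1)].
  by rewrite k1E eqxx ji gt1.
rewrite -ltnNge => gt2.
have [k2 k2E] := preim (x j + 2) gt2.
have b2 : x j < x k2 < x i.
  by rewrite k2E gt2 andbT addn2 ltnS leqnSn.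
have [lt2|/= gt2'] := orP (side _ b2).
  by apply/orP; left; apply/existsP; exists k2; rewrite lt2.
apply/orP; right; have k12 : k1 != k2.
  by apply/eqP => e; move: k2E; rewrite -e k1E => /addnI.
have -> : 2 = #|[set k1; k2]| by rewrite cards2 k12.
apply/subset_leq_card/subsetP => k; rewrite !inE.
by case/orP=> /eqP->; rewrite ?gt1 ?gt2' ?b1 ?b2.
Qed.

Lemma weight_swap n (x : 'S_n) (i j : 'I_n) :
  swappable x i j -> weight (swap x i j) < weight x.
Proof.
case/and3P=> /eqP ji lt_x _; have nij : j != i by rewrite -val_eqE /= ji gtn_eqF.
rewrite /weight (bigD1 i) //= (bigD1 j) //= addnA.
rewrite [X in _ < X](bigD1 i) //= [X in _ < _ + X](bigD1 j) //= addnA.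
set s1 := \sum_(_ < _ | _) _; set s2 := \sum_(_ < _ | _) _.
have -> : s1 = s2.
  apply: eq_bigr => k /andP[ki kj]; rewrite permM tpermD // eq_sym //.
rewrite ltn_add2r !permM tpermL tpermR ji.
have -> : n - i = (n - i.+1).+1 by rewrite -subSn // -ji.
by rewrite !mulSn -!addnA [X in _ + X < _]addnC ltn_add2r.
Qed.

Lemma pi_down_rec_enough n m1 m2 (x : 'S_n) :
  weight x <= m1 -> weight x <= m2 -> pi_down_rec m1 x = pi_down_rec m2 x.
Proof.
elim: m1 m2 x => [|m1 IH] [|m2] x //= le1 le2; case: ifP => // _;
  case: pickP => //= ij /weight_swap lt_w.
- by have := leq_trans lt_w le1.
- by have := leq_trans lt_w le2.
by apply: IH; rewrite -ltnS (leq_trans lt_w).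
Qed.

Lemma pi_down_eq n (x : 'S_n) :
  pi_down x =
    if Pell x then x else
    if [pick ij : 'I_n * 'I_n | swappable x ij.1 ij.2] is Some ij
    then pi_down (swap x ij.1 ij.2) else x.
Proof.
rewrite /pi_down (@pi_down_rec_enough _ _ (weight x).+1) //=.
case: ifP => // _; case: pickP => // ij /weight_swap lt_w.
by apply: pi_down_rec_enough => //; apply: ltnW.
Qed.

Lemma Pell_pi_down n (x : 'S_n) : Pell (pi_down x).
Proof.
have [m] := ubnP (weight x); elim: m x => // m IH x lt_m.
rewrite pi_down_eq; case: ifP => // /negbT /Pell_or_swappable [ij0 sw0].
case: pickP => [ij /weight_swap lt_w|/(_ ij0)]; last by rewrite sw0.
by apply: IH; apply: leq_trans lt_w _.
Qed.

(* Both a and b are letters of x, and b is to the right of a. *)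
Definition right_of n (x : 'S_n) (b a : nat) : bool :=
  [exists i : 'I_n, exists j : 'I_n,
     [&& i < j, x i == a :> nat & x j == b :> nat]].

Definition left_of n (x : 'S_n) (b a : nat) : bool := right_of x a b.

Definition sigma_rectangle n (x : 'S_n) (i : nat) : bool :=
  right_of x i.+1 i && left_of x i.+2 i.

Definition sigma_cell n (x : 'S_n) (i : nat) : cell :=
  if sigma_rectangle x i then LeftHalf
  else if (0 < i) && sigma_rectangle x i.-1 then RightHalf
  else if right_of x i.+1 i then Black else White.

Lemma right_ofE n (x : 'S_n) (a b : 'I_n) :
  right_of x b a = ((x^-1)%g a < (x^-1)%g b).
Proof.
apply/existsP/idP => [[i /existsP[j /and3P[lt_ij /eqP/val_inj<- /eqP/val_inj<-]]]|lt].
  by rewrite !permK.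
by exists ((x^-1)%g a); apply/existsP; exists ((x^-1)%g b); rewrite lt !permKV !eqxx.
Qed.

Lemma right_of_ltn n (x : 'S_n) b a : right_of x b a -> (a < n) && (b < n).
Proof. by case/existsP=> i /existsP[j /and3P[_ /eqP<- /eqP<-]]; rewrite !ltn_ord. Qed.

Lemma right_of_trans n (x : 'S_n) b a c :
  right_of x b a -> right_of x c b -> right_of x c a.
Proof.
move=> ab bc; have [/andP[la lb] /andP[_ lc]] := (right_of_ltn ab, right_of_ltn bc).
move: ab bc; rewrite (right_ofE x (Ordinal la) (Ordinal lb)).
rewrite (right_ofE x (Ordinal lb) (Ordinal lc)) (right_ofE x (Ordinal la) (Ordinal lc)).
exact: ltn_trans.
Qed.

Lemma right_of_asym n (x : 'S_n) b a : right_of x b a -> right_of x a b = false.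
Proof.
move=> ab; have /andP[la lb] := right_of_ltn ab; move: ab.
rewrite (right_ofE x (Ordinal la) (Ordinal lb)) (right_ofE x (Ordinal lb) (Ordinal la)).
by move=> lt; rewrite ltnNge ltnW.
Qed.

Lemma sigma_rectangleS n (x : 'S_n) i :
  sigma_rectangle x i -> sigma_rectangle x i.+1 = false.
Proof.
case/andP=> r l; apply/negbTE; rewrite /sigma_rectangle negb_and.
by rewrite (right_of_asym (right_of_trans l r)).
Qed.

Lemma sigma_tiling n (x : 'S_n) :
  is_tiling [tuple sigma_cell x i | i < n.-1].
Proof.
have nthE i : i < n.-1 ->
    nth Black [tuple sigma_cell x i | i < n.-1] i = sigma_cell x i.
  by move=> lt_i; have := nth_mktuple (fun i : 'I_n.-1 => sigma_cell x i) Black (Ordinal lt_i).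
apply: is_tilingP => [|i]; rewrite size_tuple => lt_i.
  by rewrite nthE // /sigma_cell; case: ifP => // _; case: ifP.
rewrite nthE // [LHS](_ : _ = sigma_rectangle x i); last first.
  by rewrite /sigma_cell; case: ifP => // _; do 2?[case: ifP => // _].
have [ge|lt] := leqP n.-1 i.+1.
  rewrite nth_default ?size_tuple //; apply/negbTE/negP => /andP[_ /right_of_ltn/andP[lt2 _]].
  by move: ge; rewrite leqNgt ltn_predRL lt2.
rewrite nthE // /sigma_cell /=.
case: (boolP (sigma_rectangle x i)) => [/sigma_rectangleS->//|_].
by case: ifP => //; case: ifP.
Qed.

Definition sigma n (x : 'S_n) : sash n := Sash (sigma_tiling x).

(* sigma maps the Pell permutations bijectively onto the sashes, so that the
   default value is never used. *)
Definition eta n (D : sash n) : 'S_n :=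
  odflt 1%g [pick x : 'S_n | Pell x && (sigma x == D)].

(* The elements of T, in increasing order. *)
Definition labels n (T : {set 'I_n}) : seq nat := [seq val t | t in T].

Definition one_line n (x : 'S_n) : seq nat := [seq val (x i) | i : 'I_n].

Definition perm_of_word n (w : seq nat) : 'S_n :=
  odflt 1%g [pick x : 'S_n | one_line x == w].

(* The word (x)_T, for #|T| = p. *)
Definition relabel n (T : {set 'I_n}) p (x : 'S_p) : seq nat :=
  [seq nth 0 (labels T) (x i) | i : 'I_p].

(* The word (x)_T . (y)_(T^C), as a permutation. *)
Definition shuffle p q (T : {set 'I_(p + q)}) (x : 'S_p) (y : 'S_q) :
    'S_(p + q) :=
  perm_of_word (p + q) (relabel T x ++ relabel (~: T) y).

Lemma perm_of_wordK n (w : seq nat) :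
  perm_eq w (iota 0 n) -> one_line (perm_of_word n w) = w.
Proof.
move=> pw; have sw : size w = n by rewrite (perm_size pw) size_iota.
have lt_w (i : 'I_n) : nth 0 w i < n.
  have := mem_nth 0 (eq_ind_r (fun m => i < m) (ltn_ord i) sw).
  by rewrite (perm_mem pw) mem_iota.
have inj : injective (fun i => Ordinal (lt_w i)).
  move=> i j /(congr1 val) /= /eqP.
  by rewrite nth_uniq ?sw // ?(perm_uniq pw) ?iota_uniq // => /eqP/val_inj.
rewrite /perm_of_word; case: pickP => [x /eqP //|/(_ (perm inj))/eqP[]].
rewrite /one_line /image_mem; apply: (@eq_from_nth _ 0).
  by rewrite size_map -cardE card_ord.
move=> i; rewrite size_map -cardE card_ord => lt_i.
rewrite (nth_map (Ordinal lt_i)) -?cardE ?card_ord // permE /=.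
by rewrite nth_enum_ord.
Qed.

Lemma one_line_shuffle p q (T : {set 'I_(p + q)}) (x : 'S_p) (y : 'S_q) :
  #|T| = p -> one_line (shuffle T x y) = relabel T x ++ relabel (~: T) y.
Proof.
move=> cT; apply: perm_of_wordK.
have cTC : #|~: T| = q by apply: (@addnI p); rewrite -{1}cT cardsC card_ord.
have rl m (A : {set 'I_(p + q)}) (z : 'S_m) :
    #|A| = m -> perm_eq (relabel A z) (labels A).
  move=> cA; have sA : size (labels A) = m by rewrite size_map -cardE.
  rewrite /relabel /image_mem (map_comp (nth 0 (labels A)) (fun i => val (z i))).
  rewrite -[X in perm_eq _ X](mkseq_nth 0) /mkseq.
  apply: perm_map; rewrite sA -val_enum_ord [X in perm_eq X _](map_comp val z).
  apply: perm_map.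
  apply: uniq_perm.
  - by rewrite map_inj_uniq ?enum_uniq //; apply: perm_inj.
  - exact: enum_uniq.
  by move=> k; rewrite mem_enum -[k](permKV z) (mem_map perm_inj) mem_enum.
apply: (perm_trans (perm_cat (rl _ _ _ cT) (rl _ _ _ cTC))).
rewrite -map_cat -val_enum_ord; apply: perm_map; apply: uniq_perm.
- rewrite cat_uniq !enum_uniq /= andbT; apply/hasPn => k.
  by rewrite /= !mem_enum inE.
- exact: enum_uniq.
by move=> k; rewrite mem_cat !mem_enum inE orbN.
Qed.

Local Open Scope ring_scope.

Section DualProduct.
Variables (K : fieldType) (p q : nat).

Definition sigma_lin n (v : {freeg ('S_n) / K}) : {freeg (sash n) / K} :=
  fglift (fun x => << sigma x >> : {freeg (sash n) / K}) v.

(* The tensor product of the spaces spanned by [sash p] and [sash q] is the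
   space spanned by the pairs of sashes. *)
Definition tensor (D : sash p) (E : sash q) :
    {freeg (sash p * sash q)%type / K} :=
  << (D, E) >>.

Definition dual_product (v : {freeg (sash p * sash q)%type / K}) :
    {freeg (sash (p + q)) / K} :=
  fglift (fun DE : sash p * sash q =>
    sigma_lin (\sum_(T : {set 'I_(p + q)} | #|T| == p)
                  << pi_down (shuffle T (eta DE.1) (eta DE.2)) >>)) v.

End DualProduct.

Local Close Scope ring_scope.

(* The i-th arrow goes from the sash labelled with A to the one labelled with
   B. *)
Definition arrow n (A B : {set 'I_n}) (i : nat) : bool :=
  (i \in labels A) && (i.+1 \in labels B).

(* When D is labelled with A, what lies between the label i in A and the next
   larger label in A. *)
Definition after_label n m (A : {set 'I_n}) (D : sash m) (i : nat) : cell :=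
  nth Black (cells D) #|[set t in A | t < i]|.

Section Gamma.
Variables (p q : nat) (T : {set 'I_(p + q)}) (D : sash p) (E : sash q).

Definition gamma_rule1 (i : nat) : bool :=
  [&& arrow T (~: T) i, arrow (~: T) T i.+1 &
      after_label T D i \in [:: White; RightHalf]].

Definition gamma_rule2 (i : nat) : bool :=
  [&& arrow (~: T) (~: T) i, arrow (~: T) T i.+1 &
      after_label (~: T) E i \in [:: Black; LeftHalf]].

Definition gamma_rectangle (i : nat) : bool := gamma_rule1 i || gamma_rule2 i.

(* Before the replacement of the unmatched halves. *)
Definition gamma_raw (i : nat) : cell :=
  if gamma_rectangle i then LeftHalf
  else if (0 < i) && gamma_rectangle i.-1 then RightHalf
  else if arrow T T i then after_label T D i
  else if arrow (~: T) (~: T) i then after_label (~: T) E i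
  else if arrow T (~: T) i then Black
  else White.

End Gamma.

Definition repair_cell (s : seq cell) (i : nat) : cell :=
  match nth Black s i with
  | LeftHalf => if nth Black s i.+1 == RightHalf then LeftHalf else Black
  | RightHalf =>
      if (0 < i) && (nth Black s i.-1 == LeftHalf) then RightHalf else White
  | c => c
  end.

Lemma repair_tiling m (s : m.-tuple cell) :
  is_tiling [tuple repair_cell s i | i < m].
Proof.
have nthE i : i < m -> nth Black [tuple repair_cell s i | i < m] i = repair_cell s i.
  by move=> lt_i; have := nth_mktuple (fun i : 'I_m => repair_cell s i) Black (Ordinal lt_i).
apply: is_tilingP => [|i]; rewrite size_tuple => lt_i.
  by rewrite nthE // /repair_cell; case: (nth _ _ 0) => //; case: ifP.
rewrite nthE //; have [ge|lt] := leqP m i.+1.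
  rewrite nth_default ?size_tuple // /repair_cell [nth _ _ i.+1]nth_default ?size_tuple //.
  by case: (nth _ _ i) => //=; case: ifP.
rewrite nthE // /repair_cell /=.
case: (nth _ _ i) => //=; case: (nth _ _ i.+1) => //=; case: ifP => //=.
all: by case: ifP.
Qed.

Definition gamma p q (T : {set 'I_(p + q)}) (D : sash p) (E : sash q) :
    sash (p + q) :=
  Sash (repair_tiling [tuple gamma_raw T D E i | i < (p + q).-1]).

(* Main.v *)
Require Import Defs.
From mathcomp Require Import all_boot fingroup perm ssralg.
From mathcomp.multinomials Require Import freeg.
From mathcomp Require Import order zify.

Set Implicit Arguments.
Unset Strict Implicit.
Unset Printing Implicit Defensive.

(** The formula holds term by term: for every T with p elements, the permutation
    z = (x)_T . (y)_(T^C), where x = eta D and y = eta E, satisfies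
    sigma (pi_down z) = gamma_T (D (x) E).

    The map pi_down can be forgotten, because sigma depends only on the relative
    order in the word of the letters i, i+1 and of the letters i, i+2.  A swap
    allowed in the computation of pi_down exchanges two letters differing by at
    least 2; when they are a and a+2, the letter a+1 has to stand to the left of
    both, so that no rectangle of sigma starts at a, whatever the order of a and
    a+2 ([sigma_swap]).  Moreover sigma (eta D) = D: every sash is the image of
    some permutation ([sigma_surj]), hence of a Pell permutation, its image
    under pi_down.

    It remains to compare sigma z with the arrow construction applied to
    sigma x and sigma y ([sigma_shuffle]).  A sash is determined by two data
    per position: whether the cell is black or a left half, and whether it is a
    left half ([sash_eq]).  For sigma z the first says that i+1 is to the right
    of i, the second that moreover i+2 is to the left of i.  In z, two letters
    of T are ordered as their ranks are in x, two letters outside T as their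
    ranks are in y, and letters of T precede the others ([right_of_shuffle]).
    So the first datum is read off the i-th arrow, or off the cell under it when
    it stays in D or in E ([rising_gamma_raw]).  For the second, the two
    rules mark exactly the rectangles of sigma z for which i+1 lies outside T
    and i+2 in T ([gamma_rectangleE]); in any other rectangle i, i+1 and i+2 lie
    all in T or all outside T, and it is copied from D or E.  The half
    rectangles copied without their other half are those where the arrows
    leave or enter D or E in between, and the repair turns them into the squares that
    have the same first datum ([left_gamma_raw]). *)

(** * Sashes are determined by rising cells and left halves *)

(** In [sigma x] these are the cells of the positions i such that i + 1 stands
    to the right of i, see [rising_sigma_cell]. *)
Definition rising (c : cell) : bool := c \in [:: Black; LeftHalf].

Lemma tiling_halves (s : seq cell) :
  is_tiling s ->
  nth Black s 0 != RightHalf /\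
  forall i, (nth Black s i == LeftHalf) = (nth Black s i.+1 == RightHalf).
Proof.
have nthr k : nth Black (rcons s Black) k = nth Black s k.
  rewrite nth_rcons; case: ltngtP => // lk.
    by rewrite nth_default // ltnW.
  by rewrite nth_default ?lk.
move=> /(pathP Black); rewrite size_rcons => h; split.
  have := h 0 isT; rewrite /= -[rcons _ _]/(rcons s Black) nthr.
  by case: (nth _ _ _).
move=> i; case: (ltnP i (size s)) => [lt_i|ge_i].
  by have := h i.+1 lt_i; rewrite /= !nthr => /eqP.
by rewrite !nth_default // leqW.
Qed.

(** Among the cells that are not rising, a white square and a right half are
    told apart by the presence of a left half just before. *)
Lemma sash_eq n (D E : sash n) :
  (forall i, i.+1 < n ->
     rising (nth Black (cells D) i) = rising (nth Black (cells E) i)) ->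
  (forall i, i.+1 < n ->
     (nth Black (cells D) i == LeftHalf) = (nth Black (cells E) i == LeftHalf)) ->
  D = E.
Proof.
move=> eqR eqL; apply/val_inj/val_inj/(@eq_from_nth _ Black).
  by rewrite !size_tuple.
move=> i; rewrite size_tuple ltn_predRL => lt_i.
have [D0 DS] := tiling_halves (cells_tiling D).
have [E0 ES] := tiling_halves (cells_tiling E).
have : (nth Black (cells D) i == RightHalf) =
       (nth Black (cells E) i == RightHalf).
  case: i lt_i => [|i] lt_i; first by rewrite (negbTE D0) (negbTE E0).
  by rewrite -DS -ES eqL // ltnW.
have := eqL _ lt_i; have := eqR _ lt_i.
by rewrite /rising; case: (nth _ (cells D) i); case: (nth _ (cells E) i).
Qed.

(** * The two data read off a permutation *)

Lemma right_of_total n (x : 'S_n) a b :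
  a < n -> b < n -> a != b -> right_of x a b = ~~ right_of x b a.
Proof.
move=> lt_a lt_b ne; rewrite (right_ofE x (Ordinal lt_a) (Ordinal lt_b)).
rewrite (right_ofE x (Ordinal lt_b) (Ordinal lt_a)).
by case: ltngtP => // /val_inj/perm_inj[e]; rewrite e eqxx in ne.
Qed.

Lemma right_of_one_line n (x : 'S_n) a b :
  a < n -> b < n ->
  right_of x b a = (index a (one_line x) < index b (one_line x)).
Proof.
move=> lt_a lt_b; have inj : injective (fun i : 'I_n => val (x i)).
  by move=> i j /val_inj/perm_inj.
have idx i (lt_i : i < n) : index i (one_line x) = (x^-1)%g (Ordinal lt_i).
  set k := (x^-1)%g _; have -> : i = x k by rewrite permKV.
  exact: etrans (index_map inj _ k) (index_enum_ord k).
by rewrite !idx -right_ofE.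
Qed.

Lemma nth_sigma n (x : 'S_n) i :
  i.+1 < n -> nth Black (cells (sigma x)) i = sigma_cell x i.
Proof.
rewrite -ltn_predRL => lt_i.
by have := nth_mktuple (fun i : 'I_n.-1 => sigma_cell x i) Black (Ordinal lt_i).
Qed.

(** At a right half, i stands to the right of i - 1, itself to the right of
    i + 1; so the right halves fall on the side of the white squares. *)
Lemma rising_sigma_cell n (x : 'S_n) i :
  rising (sigma_cell x i) = right_of x i.+1 i.
Proof.
rewrite /sigma_cell; case: ifP => [/andP[-> _]//|_].
case: ifP => [/andP[i0 /andP[r l]]|_]; last by case: (right_of _ _ _).
by case: i i0 r l => // i _ r l; rewrite (right_of_asym (right_of_trans l r)).
Qed.

Lemma left_sigma_cell n (x : 'S_n) i :
  (sigma_cell x i == LeftHalf) = sigma_rectangle x i.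
Proof. by rewrite /sigma_cell; do 3?[case: ifP => // _]. Qed.

Lemma sigma_eq n (x : 'S_n) (D : sash n) :
  (forall i, i.+1 < n -> right_of x i.+1 i = rising (nth Black (cells D) i)) ->
  (forall i, i.+1 < n ->
     sigma_rectangle x i = (nth Black (cells D) i == LeftHalf)) ->
  sigma x = D.
Proof.
move=> eqR eqL; apply: sash_eq => i lt_i; rewrite nth_sigma //.
  by rewrite rising_sigma_cell eqR.
by rewrite left_sigma_cell eqL.
Qed.

Lemma sigma_cell_rectangle n (x : 'S_n) i :
  (sigma_cell x i == LeftHalf) && (sigma_cell x i.+1 == RightHalf) =
  sigma_rectangle x i.
Proof.
rewrite left_sigma_cell; case: (boolP (sigma_rectangle x i)) => //= ri.
by rewrite /sigma_cell sigma_rectangleS //= ri.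
Qed.

(** * The map sigma is constant on the fibres of pi_down *)

Lemma right_of_swap n (x : 'S_n) (i j : 'I_n) b a :
  j = i.+1 :> nat -> ~~ ((a == x i :> nat) && (b == x j :> nat)) ->
  ~~ ((a == x j :> nat) && (b == x i :> nat)) ->
  right_of (swap x i j) b a = right_of x b a.
Proof.
move=> ji nij nji.
have [lt_an|] := ltnP a n; last first.
  by move=> ge_a; apply/idP/idP => /right_of_ltn; rewrite ltnNge ge_a.
have [lt_bn|] := ltnP b n; last first.
  by move=> ge_b; apply/idP/idP => /right_of_ltn; rewrite andbC ltnNge ge_b.
rewrite (right_ofE _ (Ordinal lt_an) (Ordinal lt_bn)).
rewrite (right_ofE _ (Ordinal lt_an) (Ordinal lt_bn)).
rewrite /swap invMg !permM tpermV.
set u := (x^-1)%g _; set v := (x^-1)%g _.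
have ua : a = x u by rewrite permKV.
have vb : b = x v by rewrite permKV.
move: nij nji; rewrite ua vb !val_eqE !(inj_eq perm_inj) -!val_eqE /=.
case: tpermP => [->|->|/eqP + /eqP]; case: tpermP => [->|->|/eqP + /eqP];
  rewrite -?val_eqE /=; lia.
Qed.

(** Two letters exchanged by an allowed swap are never consecutive, so the order
    of a and a + 1 is kept for all a.  The order of a and a + 2 changes only
    when these are the two letters swapped; the only value in between, a + 1,
    then stands to their left, and no rectangle starts at a before or after. *)
Lemma sigma_swap n (x : 'S_n) (i j : 'I_n) :
  swappable x i j -> sigma (swap x i j) = sigma x.
Proof.
case/and3P=> /eqP ji lt_x vals.
have two k l : x j < x k < x i -> x j < x l < x i -> k != l ->
    x j + 2 < x i.
  by rewrite -(inj_eq (@perm_inj _ x)) -val_eqE /=; lia.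
have far : x i != x j + 1 :> nat.
  case/orP: vals => [/existsP[k]|/card_gt1P[k [l [+ + _]]]]; rewrite ?inE; lia.
have keep a : right_of (swap x i j) a.+1 a = right_of x a.+1 a.
  by apply: right_of_swap => //; lia.
apply: sigma_eq => a lt_a; rewrite nth_sigma ?rising_sigma_cell ?keep //.
rewrite left_sigma_cell /sigma_rectangle keep.
(* With a + 1 to the left of a, there is no rectangle in either word. *)
have [ra|//] := boolP (right_of x a.+1 a).
rewrite /left_of; apply: right_of_swap => //; first last.
  by apply/negP => /andP[/eqP e1 /eqP e2]; lia.
apply/negP => /andP[/eqP e1 /eqP e2].
case/orP: vals => [/existsP[k /andP[lt_k bk]]|]; last first.
  case/card_gt1P=> k [l []]; rewrite !inE => /andP[_ bk] /andP[_ bl] ne.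
  by have := two _ _ bk bl ne; lia.
have ek : x k = a.+1 :> nat by lia.
move: ra; rewrite -ek e2 right_ofE !permK; lia.
Qed.

Lemma sigma_pi_down n (x : 'S_n) : sigma (pi_down x) = sigma x.
Proof.
have [m] := ubnP (weight x); elim: m x => // m IH x lt_m.
rewrite pi_down_eq; case: ifP => // _; case: pickP => // ij sw.
by rewrite IH ?(sigma_swap sw) // (leq_trans (weight_swap sw)).
Qed.

(** * The map sigma is onto *)

(** The permutations of the n letters are the strict orders on them, and it is
    easier to give an order by numerical keys than to build a word. *)
Lemma perm_of_keys n (key : 'I_n -> nat) :
  injective key ->
  exists x : 'S_n, forall a b : 'I_n, right_of x b a = (key a < key b).
Proof.
move=> inj_key.
have lt_rank (a : 'I_n) : #|[set b | key b < key a]| < n.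
  rewrite -[X in _ < X]card_ord -cardsT; apply: proper_card.
  apply/properP; split; first exact: subsetT.
  by exists a; rewrite !inE ?ltnn.
have mono (a b : 'I_n) : key a < key b ->
    #|[set c | key c < key a]| < #|[set c | key c < key b]|.
  move=> lt_ab; apply: proper_card; apply/properP; split.
    by apply/subsetP => c; rewrite !inE => /ltn_trans; apply.
  by exists a; rewrite !inE ?ltnn.
have inj : injective (fun a => Ordinal (lt_rank a)).
  move=> a b [e]; apply: inj_key.
  by case: (ltngtP (key a) (key b)) => // /mono; rewrite e ltnn.
exists (perm inj)^-1%g => a b; rewrite right_ofE invgK !permE /=.
case: (ltngtP (key a) (key b)) => [/mono //|/mono|/inj_key->].
  by move=> lt_ba; rewrite ltnNge ltnW.
by rewrite ltnn.
Qed.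

(** The letters are inserted in increasing order, the letter a according to the
    cell c at position a - 1: at the far right if c is black or a left half; at
    the far left if c is a right half, which makes a precede a - 2; if c is
    white, directly to the left of a - 1 when a - 1 stands at the far right, so
    that no rectangle is created at a - 2, and else at the far left. *)
Lemma sigma_surj n (D : sash n) : exists x : 'S_n, sigma x = D.
Proof.
pose c := nth Black (cells D).
(* The letters below a have their keys within 2 (a - 1) of the centre 2 n.  The
   key 2 n + 2 a - 3 lies between those of a - 1, which is 2 n + 2 (a - 1), and
   of all smaller letters; being odd, it is not a key of the other kinds. *)
pose key (a : nat) :=
  if a is a'.+1 then
    if rising (c a') then 2 * n + 2 * a
    else if [&& c a' == White, 0 < a' & rising (c a'.-1)] then 2 * n + 2 * a - 3
    else 2 * n - 2 * a
  else 2 * n.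
have inj : injective (fun a : 'I_n => key a).
  move=> [a lta] [b ltb] /= e; apply/val_inj => /=; move: e; rewrite /key.
  by case: a lta => [|a] lta; case: b ltb => [|b] ltb; do ?case: ifP; lia.
have [x xP] := perm_of_keys inj.
have rE a b : a < n -> b < n -> right_of x b a = (key a < key b).
  by move=> la lb; rewrite (xP (Ordinal la) (Ordinal lb)).
have [_ DS] := tiling_halves (cells_tiling D).
rewrite -/c in DS.
have R i : i.+1 < n -> right_of x i.+1 i = rising (c i).
  move=> lt_i; rewrite rE //; last lia.
  rewrite /key; case: (boolP (rising (c i))) => [_|].
    case: i lt_i => [|i] lt_i; first lia.
    by do ?case: ifP => _; lia.
  case: i lt_i => [|i] lt_i /=; first by rewrite andbF; lia.
  move=> nr; case: (boolP (rising (c i))) => [ri|nri].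
    by case: ifP => _; lia.
  by rewrite andbF; case: ifP => _; lia.
exists x; apply: sigma_eq => i lt_i; first exact: R.
rewrite /sigma_rectangle R // -/(c i) /left_of.
have [lt2|ge2] := ltnP i.+2 n; last first.
  have -> : right_of x i i.+2 = false.
    by apply/negbTE/negP => /right_of_ltn /andP[]; lia.
  rewrite andbF DS /c nth_default // size_tuple; lia.
rewrite rE //; last lia.
have /andP[lo hi] : 2 * n - 2 * i <= key i <= 2 * n + 2 * i.
  by rewrite /key; case: i {lt_i lt2} => [|i]; do ?case: ifP => _; lia.
have := DS i; rewrite [key i.+2]/key /rising /=.
by case: (c i); case: (c i.+1) => //= _; apply/idP/eqP => //; lia.
Qed.

(** A permutation with image D may be replaced by its image under pi_down, which
    is Pell: so the choice made by [eta] is possible. *)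
Lemma sigma_eta n (D : sash n) : sigma (eta D) = D.
Proof.
rewrite /eta; case: pickP => [x /andP[_ /eqP]//|none].
have [x xD] := sigma_surj D.
by have := none (pi_down x); rewrite Pell_pi_down sigma_pi_down xD eqxx.
Qed.

(** * The order of the letters in a shuffle *)

Definition label_rank n (A : {set 'I_n}) (i : nat) : nat :=
  #|[set t in A | t < i]|.

Lemma mem_labels n (A : {set 'I_n}) (i : 'I_n) :
  (val i \in labels A) = (i \in A).
Proof. by rewrite mem_map ?mem_enum //; apply: val_inj. Qed.

Lemma labels_ltn n (A : {set 'I_n}) i : i \in labels A -> i < n.
Proof. by case/mapP=> t _ ->; apply: ltn_ord. Qed.

Lemma mem_labels_setC n (A : {set 'I_n}) i :
  i < n -> (i \in labels (~: A)) = (i \notin labels A).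
Proof. by move=> lt_i; rewrite !(mem_labels _ (Ordinal lt_i)) inE. Qed.

Lemma size_labels n (A : {set 'I_n}) : size (labels A) = #|A|.
Proof. by rewrite size_map -cardE. Qed.

Lemma nth_labels n (A : {set 'I_n}) i :
  i \in labels A ->
  label_rank A i < #|A| /\ nth 0 (labels A) (label_rank A i) = i.
Proof.
move=> iA; have srt : sorted <%O (labels A).
  have -> : labels A = [seq val t | t <- enum 'I_n & t \in A].
    by rewrite /labels /image_mem {1}/enum_mem -enumT.
  apply: (subseq_sorted ltn_trans (map_subseq _ (filter_subseq _ _))).
  by rewrite val_enum_ord; apply: iota_ltn_sorted.
have -> : label_rank A i = index i (labels A).
  have lt_i : index i (labels A) < size (labels A) by rewrite index_mem.
  rewrite -[RHS](Order.PreorderTheory.count_lt_nth 0 srt lt_i) nth_index //.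
  rewrite /label_rank /labels /image_mem count_map cardE /enum_mem.
  rewrite -size_filter -filter_predI; congr size.
  by apply: eq_filter => t; rewrite !inE andbC.
by rewrite nth_index // -size_labels index_mem.
Qed.

Lemma label_rankS n (A : {set 'I_n}) i :
  i < n -> label_rank A i.+1 = label_rank A i + (i \in labels A).
Proof.
move=> lt_i; rewrite (mem_labels _ (Ordinal lt_i)) /label_rank.
have [iA|niA] := boolP (Ordinal lt_i \in A).
  rewrite (cardsD1 (Ordinal lt_i)) !inE iA /= ltnSn addnC; congr (_ + _).
  by apply: eq_card => t; rewrite !inE -val_eqE /=; lia.
rewrite addn0; apply: eq_card => t; rewrite !inE ltnS leq_eqVlt.
have [e|//] := eqVneq (val t) i.
suff -> : t \in A = false by [].
by apply: contraNF niA; rewrite (_ : Ordinal _ = t) //; apply: val_inj.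
Qed.

Lemma mem_relabel n (A : {set 'I_n}) m (z : 'S_m) i :
  #|A| = m -> (i \in relabel A z) = (i \in labels A).
Proof.
move=> cA; apply/mapP/idP => [[k _ ->]|iA].
  by apply: mem_nth; rewrite size_labels cA.
have [lt_r e] := nth_labels iA; rewrite cA in lt_r.
by exists ((z^-1)%g (Ordinal lt_r)); rewrite ?mem_enum // permKV /= e.
Qed.

Lemma right_of_relabel n (A : {set 'I_n}) m (z : 'S_m) a b :
  #|A| = m -> a \in labels A -> b \in labels A ->
  right_of z (label_rank A b) (label_rank A a) =
  (index a (relabel A z) < index b (relabel A z)).
Proof.
move=> cA aA bA.
have [lt_a ea] := nth_labels aA; have [lt_b eb] := nth_labels bA.
rewrite cA in lt_a lt_b.
have inj : injective (fun i : 'I_m => nth 0 (labels A) (z i)).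
  move=> i j /eqP; rewrite nth_uniq ?size_labels ?cA //; last first.
    by rewrite map_inj_uniq ?enum_uniq //; apply: val_inj.
  by move=> /eqP/val_inj/perm_inj.
have idx i (lt_i : i < m) :
    index (nth 0 (labels A) i) (relabel A z) = (z^-1)%g (Ordinal lt_i).
  set k := (z^-1)%g _; have -> : i = z k by rewrite permKV.
  exact: etrans (index_map inj _ k) (index_enum_ord k).
by rewrite -{2}ea -{2}eb !idx -right_ofE.
Qed.

(** The label j certifies that there is a label after i, so that the cell read in
    [after_label] is inside the sash and not the default value. *)
Lemma after_label_sigma n (A : {set 'I_n}) m (x : 'S_m) i j :
  #|A| = m -> j \in labels A -> label_rank A j = (label_rank A i).+1 ->
  after_label A (sigma x) i = sigma_cell x (label_rank A i).
Proof.
move=> cA jA e; rewrite /after_label nth_sigma // -e -[X in _ < X]cA.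
by have [] := nth_labels jA.
Qed.

Lemma not_rising c : (c \in [:: White; RightHalf]) = ~~ rising c.
Proof. by case: c. Qed.

(** The repair turns left halves into black squares and right halves into white
    squares, both on the same side of the partition given by [rising]. *)
Lemma rising_repair s i : rising (repair_cell s i) = rising (nth Black s i).
Proof. by rewrite /repair_cell; case: (nth _ s i) => //; case: ifP. Qed.

Lemma left_repair s i :
  (repair_cell s i == LeftHalf) =
  (nth Black s i == LeftHalf) && (nth Black s i.+1 == RightHalf).
Proof. by rewrite /repair_cell; case: (nth _ s i) => //; case: ifP. Qed.

Section ShuffleGamma.
Variables (p q : nat) (T : {set 'I_(p + q)}) (x : 'S_p) (y : 'S_q).
Hypothesis cT : #|T| = p.
Let n := p + q.
Let cTC : #|~: T| = q.
Proof. by apply: (@addnI p); rewrite -{1}cT cardsC card_ord. Qed.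
Let z := shuffle T x y.
Let raw := gamma_raw T (sigma x) (sigma y).
Let rect := gamma_rectangle T (sigma x) (sigma y).

Lemma right_of_shuffle a b : a < n -> b < n ->
  right_of z b a =
  if a \in labels T then
    (b \notin labels T) || right_of x (label_rank T b) (label_rank T a)
  else
    (b \notin labels T) &&
    right_of y (label_rank (~: T) b) (label_rank (~: T) a).
Proof.
move=> lt_a lt_b; rewrite right_of_one_line // one_line_shuffle // !index_cat.
rewrite !mem_relabel //.
have lt_idx c : c \in labels T -> index c (relabel T x) < size (relabel T x).
  by move=> cA; rewrite index_mem mem_relabel.
have [aT|naT] := boolP (a \in labels T); have [bT|nbT] := boolP (b \in labels T).
- by rewrite /= right_of_relabel.
- by rewrite ltn_addr ?lt_idx.
- by rewrite ltnNge ltnW // ltn_addr ?lt_idx.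
by rewrite /= ltn_add2l right_of_relabel ?mem_labels_setC.
Qed.

(** * The arrow construction computes sigma of the shuffle *)

(** When i+1 lies outside T and i+2 in T, a rectangle of [sigma z] is recognized
    by one comparison inside one of the two words.  If i is in T, then i + 1 is
    to the right of i for free, and i, i + 2 are consecutive labels in T: the
    cell of D between them says whether i + 2 is to the left of i (first rule).
    If i is outside T, then i + 2 is to the left of i for free, and the cell of
    E between i and i + 1 decides (second rule). *)
Lemma gamma_rectangleE i :
  rect i = [&& i.+1 \notin labels T, i.+2 \in labels T & sigma_rectangle z i].
Proof.
rewrite /rect /gamma_rectangle /gamma_rule1 /gamma_rule2 /arrow.
have [T2|nT2] := boolP (i.+2 \in labels T); last by rewrite !andbF.
have lt2 := labels_ltn T2; have lt1 := ltnW lt2; have lt0 := ltnW lt1.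
rewrite !mem_labels_setC // not_rising -/(rising _).
have [_|T1] := boolP (i.+1 \in labels T); first by rewrite !andbF.
rewrite /sigma_rectangle /left_of !right_of_shuffle // T2 (negbTE T1) /=.
have [T0|T0] := boolP (i \in labels T) => /=.
  have rS : label_rank T i.+2 = (label_rank T i).+1.
    by rewrite !label_rankS // T0 (negbTE T1) addn0 addn1.
  rewrite orbF (after_label_sigma _ cT T2 rS) rising_sigma_cell.
  have [lt_r _] := nth_labels T2; rewrite cT rS in lt_r.
  by rewrite rS -right_of_total ?neq_ltn ?ltnSn // ltnW.
have rS : label_rank (~: T) i.+1 = (label_rank (~: T) i).+1.
  by rewrite label_rankS // mem_labels_setC // T0 addn1.
rewrite andbT (after_label_sigma _ cTC _ rS) ?mem_labels_setC //.
by rewrite rising_sigma_cell rS.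
Qed.

Lemma gamma_rawE i : i.+1 < n ->
  raw i =
  if rect i then LeftHalf
  else if (0 < i) && rect i.-1 then RightHalf
  else match i \in labels T, i.+1 \in labels T with
       | true, true => sigma_cell x (label_rank T i)
       | false, false => sigma_cell y (label_rank (~: T) i)
       | true, false => Black
       | false, true => White
       end.
Proof.
move=> lt1; have lt0 := ltnW lt1.
rewrite /raw /gamma_raw -/(rect i) -/(rect i.-1).
case: ifP => // _; case: ifP => // _; rewrite /arrow !mem_labels_setC //.
have [T0|T0] := boolP (i \in labels T);
  have [T1|T1] := boolP (i.+1 \in labels T) => //=.
  by rewrite (after_label_sigma _ cT T1) // label_rankS // T0 addn1.
rewrite (@after_label_sigma _ _ _ y _ i.+1) ?mem_labels_setC //.
by rewrite label_rankS // mem_labels_setC // T0 addn1.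
Qed.

Lemma rising_gamma_raw i : i.+1 < n -> rising (raw i) = right_of z i.+1 i.
Proof.
move=> lt1; have lt0 := ltnW lt1; rewrite gamma_rawE //.
case: ifP => [|_]; first by rewrite gamma_rectangleE => /and4P[_ _ ->].
rewrite right_of_shuffle // !label_rankS // mem_labels_setC //.
case: ifP => [|_].
  case: i lt1 lt0 => // i lt1 lt0 /andP[_]; rewrite gamma_rectangleE.
  by case/and3P=> /negbTE -> ->.
by do 2![case: ifP => _]; rewrite //= rising_sigma_cell addn1.
Qed.

(** A rectangle is left in place by the repair when both its halves are there.
    Those placed by the rules always are.  Copied halves come from consecutive
    positions of the same sash exactly when i, i + 1 and i + 2 have all their
    labels on that sash; otherwise a copied half stands alone. *)
Lemma left_gamma_raw i : i.+2 < n ->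
  (raw i == LeftHalf) && (raw i.+1 == RightHalf) = sigma_rectangle z i.
Proof.
move=> lt2; have lt1 := ltnW lt2; have lt0 := ltnW lt1.
have rects := gamma_rectangleE.
rewrite !gamma_rawE //=.
have [ri|nri] := boolP (rect i).
  have := ri; rewrite rects => /and3P[_ T2 ->].
  by rewrite rects T2 /=.
have shuf a b la lb := @right_of_shuffle a b la lb.
case: ifP => [/andP[i_gt0]|_].
  rewrite rects /sigma_rectangle prednK // => /and3P[T0 T1 _].
  by rewrite /= shuf // T1 (negbTE T0).
(* The second rule at i + 1 may overwrite a copied cell with a left half, but
   two rectangles of a sash never overlap. *)
have [|_] := boolP (rect i.+1).
  rewrite rects andbF => /and3P[_ _ ri1]; apply/esym/negP => ri0.
  by rewrite (sigma_rectangleS ri0) in ri1.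
move: nri; rewrite rects /sigma_rectangle /left_of !shuf //.
rewrite !label_rankS // !mem_labels_setC //.
case: (i \in _); case: (i.+1 \in _); case: (i.+2 \in _);
  rewrite /= ?(addn0, addn1) ?andbF ?andbT => nri;
  rewrite ?(negbTE nri) //; exact: sigma_cell_rectangle.
Qed.

Lemma sigma_shuffle : sigma z = gamma T (sigma x) (sigma y).
Proof.
pose s := [tuple gamma_raw T (sigma x) (sigma y) i | i < n.-1].
have nth_s i : nth Black s i = if i.+1 < n then raw i else Black.
  rewrite -ltn_predRL; case: ifP => [lt_i|/negbT].
    exact: (nth_mktuple (fun i : 'I_n.-1 => raw i) Black (Ordinal lt_i)).
  by rewrite -leqNgt => ge_i; rewrite nth_default // size_tuple.
have nth_g i : i.+1 < n ->
    nth Black (cells (gamma T (sigma x) (sigma y))) i = repair_cell s i.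
  rewrite -ltn_predRL => lt_i.
  exact: (nth_mktuple (fun i : 'I_n.-1 => repair_cell s i) Black (Ordinal lt_i)).
apply: sigma_eq => i lt1; rewrite nth_g //.
  by rewrite rising_repair nth_s lt1 rising_gamma_raw.
rewrite left_repair !nth_s lt1.
(* The last position cannot start a rectangle: there is no letter i + 2. *)
case: ifP => [lt2|/negbT ge2]; first by rewrite left_gamma_raw.
rewrite andbF; apply/negbTE/negP => /andP[_ /right_of_ltn/andP[lt2 _]].
by rewrite lt2 in ge2.
Qed.

End ShuffleGamma.

(** * Linear extension *)

Local Open Scope ring_scope.

Lemma fglift_sum (R : nzRingType) (L : choiceType) (M : lmodType R)
    (f : L -> M) (I : finType) (P : pred I) (F : I -> {freeg L / R}) :
  fglift f (\sum_(i | P i) F i) = \sum_(i | P i) fglift f (F i).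
Proof.
have B := lift_is_additive f.
have Z : fglift f 0 = 0.
  by rewrite -[X in fglift f X](GRing.subrr 0) B GRing.subrr.
have N v : fglift f (- v) = - fglift f v.
  by rewrite -[- v]GRing.sub0r B Z GRing.sub0r.
by apply: big_morph => // u v; rewrite -{1}[v]GRing.opprK B N GRing.opprK.
Qed.

Theorem theorem3p7 (K : fieldType) (p q : nat) (D : sash p) (E : sash q) :
  dual_product (tensor K D E) =
  \sum_(T : {set 'I_(p + q)} | #|T| == p) << gamma T D E >>
    :> {freeg (sash (p + q)) / K}.
Proof.
rewrite /dual_product /tensor liftU GRing.scale1r /sigma_lin /=.
rewrite fglift_sum; apply: eq_bigr => T /eqP cT.
by rewrite liftU GRing.scale1r sigma_pi_down sigma_shuffle // !sigma_eta.
Qed.
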